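(* Let $T$ be a complete theory which is $\omega$-resilient and NTP$_{2}$. Let $\langle a_i : i<\omega\rangle$ be an indiscernible sequence and let $\varphi(x,b)$ be a formula which divides over $\{a_{2i} : i<\omega\}$. Then for all but finitely many $i<\omega$, $\neg\varphi(a_i,b)$ holds.
   Context: $\mathfrak{C}$ is the monster model of $T$. A formula $\varphi(x,b)$ divides over $A$ if there is an $A$-indiscernible sequence $\langle b_i:i<\omega\rangle$ with $b_0=b$ such that $\{\varphi(x,b_i):i<\omega\}$ is inconsistent. $T$ is NTP$_{2}$ if there is no formula $\varphi(x,y)$, array $\langle a_{i,j}:i,j<\omega\rangle$ and $k<\omega$ such that every path $\{\varphi(x,a_{i,\eta(i)}):i<\omega\}$ ($\eta:\omega\to\omega$) is consistent and every row $\{\varphi(x,a_{i,j}):j<\omega\}$ is $k$-inconsistent. $T$ is $\omega$-resilient if whenever $\langle a_i:i<\omega\rangle$ and $\langle b_i:i<\omega\rangle$ are both indiscernible sequences such that for every $k<\omega$ the sequence $\langle a_i:i\le k\rangle+\langle b_k\rangle+\langle a_i:k<i<\omega\rangle$ is indiscernible, then for every formula $\varphi(x,y)$, if $\{\varphi(x,a_i):i<\omega\}$ is consistent then so is $\{\varphi(x,b_i):i<\omega\}$. *)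

(* Defs.v *)
From mathcomp Require Import all_boot.
From mathcomp Require Import boolp classical_sets functions cardinality.

Set Implicit Arguments.
Unset Strict Implicit.
Unset Printing Implicit Defensive.

Local Open Scope classical_set_scope.
Local Open Scope card_scope.

(** * First-order logic *)

Record language := Language {
  fsym : Type;
  farity : fsym -> nat;
  rsym : Type;
  rarity : rsym -> nat
}.

(* Terms and formulas are indexed by the type [V] of their free variables:
   a formula phi(x, y) with |x| = n and |y| = m is an inhabitant of
   [formula L ('I_n + 'I_m)], and in [f_all f] the bound variable is [None]. *)
Inductive term (L : language) (V : Type) : Type :=
| t_var of V
| t_app (F : fsym L) of ('I_(farity F) -> term L V).

Inductive formula (L : language) (V : Type) : Type :=
| f_bot
| f_eq of term L V & term L V
| f_rel (P : rsym L) of ('I_(rarity P) -> term L V)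
| f_imp of formula L V & formula L V
| f_all of formula L (option V).

Arguments f_bot {L V}.

Definition f_not (L : language) (V : Type) (f : formula L V) : formula L V :=
  f_imp f f_bot.

Definition sentence (L : language) : Type := formula L void.

Record structure (L : language) := MkStructure {
  carrier :> Type;
  carrier_inhabited : inhabited carrier;
  finterp : forall F : fsym L, ('I_(farity F) -> carrier) -> carrier;
  rinterp : forall P : rsym L, ('I_(rarity P) -> carrier) -> Prop
}.

Fixpoint eval (L : language) (M : structure L) (V : Type) (v : V -> M)
    (t : term L V) : M :=
  match t with
  | t_var x => v x
  | t_app F ts => finterp (fun i => eval v (ts i))
  end.

Fixpoint sat (L : language) (M : structure L) (V : Type) (v : V -> M)
    (f : formula L V) {struct f} : Prop :=
  match f with
  | f_bot => False
  | f_eq t u => eval v t = eval v u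
  | f_rel P ts => rinterp (fun i => eval v (ts i))
  | f_imp g h => sat v g -> sat v h
  | f_all g => forall x : M, sat (oapp v x) g
  end.

Definition vcat (U V M : Type) (u : U -> M) (v : V -> M) (s : U + V) : M :=
  match s with inl i => u i | inr j => v j end.

(** * Theories *)

Definition is_model (L : language) (T : set (sentence L)) (M : structure L) :=
  forall s, T s -> sat (@of_void M) s.

Definition entails (L : language) (T : set (sentence L)) (s : sentence L) :=
  forall M : structure L, is_model T M -> sat (@of_void M) s.

Definition complete_theory (L : language) (T : set (sentence L)) :=
  (exists M : structure L, is_model T M) /\
  (forall s : sentence L, entails T s \/ entails T (f_not s)).

(** * Monster models *)

(* The type [K] stands for the cardinal kappa = |K|; this is |A| < kappa. *)
Definition card_lt (T K : Type) (A : set T) : Prop := ~ ([set: K] #<= A).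

Definition saturated (L : language) (K : Type) (M : structure L) :=
  forall (A : set M) (n : nat) (p : set (formula L ('I_n + A))),
    card_lt K A ->
    (forall q, finite_set q -> q `<=` p ->
       exists c : 'I_n -> M, forall f, q f -> sat (vcat c val) f) ->
    exists c : 'I_n -> M, forall f, p f -> sat (vcat c val) f.

Definition automorphism (L : language) (M : structure L) (h : M -> M) :=
  [/\ bijective h,
      forall (F : fsym L) x, h (finterp x) = finterp (F := F) (h \o x) &
      forall (P : rsym L) x, rinterp x <-> rinterp (P := P) (h \o x)].

Definition partial_elementary (L : language) (M : structure L) (A : set M)
    (g : A -> M) :=
  forall f : formula L A, sat val f <-> sat g f.

Definition strongly_homogeneous (L : language) (K : Type) (M : structure L) :=
  forall (A : set M) (g : A -> M),
    card_lt K A -> partial_elementary g ->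
    exists2 h : M -> M, automorphism h & forall x : A, h (val x) = g x.

(* A monster model is kappa-saturated and strongly kappa-homogeneous for some
   kappa > |L| + aleph_0; here [formula L nat] has cardinality |L| + aleph_0. *)
Definition monster_model (L : language) (T : set (sentence L))
    (C : structure L) :=
  is_model T C /\
  exists K : Type,
    [/\ card_lt K [set: formula L nat], saturated K C &
        strongly_homogeneous K C].

(** * Notions computed in the monster model

   As usual when working in a monster model [C], a small set of formulas over
   [C] is consistent when it is realized in [C]. *)

Definition consistent (L : language) (C : structure L) (n m : nat)
    (phi : formula L ('I_n + 'I_m)) (I : Type) (b : I -> 'I_m -> C) :=
  exists c : 'I_n -> C, forall i : I, sat (vcat c (b i)) phi.

(* Any k members of the family, at distinct indices, are inconsistent. *)
Definition k_inconsistent (L : language) (C : structure L) (n m : nat)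
    (phi : formula L ('I_n + 'I_m)) (k : nat) (b : nat -> 'I_m -> C) :=
  forall s : 'I_k -> nat, injective s -> ~ consistent phi (b \o s).

Definition increasing (n : nat) (s : 'I_n -> nat) :=
  forall i j : 'I_n, i < j -> s i < s j.

Definition indiscernible_over (L : language) (C : structure L) (A : set C)
    (m : nat) (a : nat -> 'I_m -> C) :=
  forall (n : nat) (f : formula L ('I_n * 'I_m + A)) (s t : 'I_n -> nat),
    increasing s -> increasing t ->
    sat (vcat (fun p => a (s p.1) p.2) val) f <->
    sat (vcat (fun p => a (t p.1) p.2) val) f.

Definition indiscernible (L : language) (C : structure L) (m : nat)
    (a : nat -> 'I_m -> C) :=
  indiscernible_over set0 a.

Definition divides_over (L : language) (C : structure L) (A : set C)
    (n m : nat) (phi : formula L ('I_n + 'I_m)) (b : 'I_m -> C) :=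
  exists c : nat -> 'I_m -> C,
    [/\ indiscernible_over A c, c 0 = b & ~ consistent phi c].

Definition NTP2 (L : language) (C : structure L) :=
  ~ exists (n m : nat) (phi : formula L ('I_n + 'I_m))
      (a : nat -> nat -> 'I_m -> C) (k : nat),
      (forall eta : nat -> nat, consistent phi (fun i => a i (eta i))) /\
      (forall i : nat, k_inconsistent phi k (a i)).

(* <a_i : i <= k> + <b_k> + <a_i : k < i < omega> *)
Definition insert_after (X : Type) (a b : nat -> X) (k i : nat) : X :=
  if i <= k then a i else if i == k.+1 then b k else a i.-1.

Definition omega_resilient (L : language) (C : structure L) :=
  forall (m : nat) (a b : nat -> 'I_m -> C),
    indiscernible a -> indiscernible b ->
    (forall k : nat, indiscernible (insert_after a b k)) ->
    forall (n : nat) (phi : formula L ('I_n + 'I_m)),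
      consistent phi a -> consistent phi b.

Definition even_part (M : Type) (n : nat) (a : nat -> 'I_n -> M) : set M :=
  [set x | exists i j, x = a (2 * i) j].

(* Main.v *)
(** Suppose phi(x, b) divides over the even part of [a], yet phi(a_i, b) holds
    infinitely often, necessarily at odd i.  Thinning out, [a] becomes an
    interleaving of e_0, e_1, ... with elements satisfying phi(x, b), and
    conjugating over the e_i along the dividing sequence c_j of b yields, for
    each j, elements d^j_i satisfying phi(x, c_j) such that e_0 d^j_0 e_1 d^j_1 ...
    has the Ehrenfeucht-Mostowski type of [a].  Say that k-inconsistent rows
    (c^s_j)_j, s < r, form an array over [a] if for each choice eta of columns
    [a] can be interleaved with elements satisfying phi(x, c^s_(eta s)), in any
    prescribed order of the s.

    Arrays with arbitrarily many rows exist.  For x to be an array over a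
    block y is expressed by a formula psi(x, y), consistent along the blocks of e
    by induction on the number of rows.  Each block (e, d^j) can be inserted among the blocks of e, so
    omega-resilience makes psi consistent along blocks with arbitrary choices of j,
    and NTP2 then makes it consistent along several (e, d^j) with different j and
    the same e.  A solution is an array to which (c_j)_j can be added as a row.
    Since the blocks (e, d^(eta i)) need not be indiscernible, one first uses
    NTP2 and the pigeonhole principle to find a badly inconsistent choice of
    eta, and then extracts an indiscernible sequence by Ramsey's theorem.

    By NTP2, in an array with many rows some choice eta makes the sequence
    c^s_(eta s), s < r, M-inconsistent, with M independent of r.  Hence every
    colouring of a finite piece of [a] is induced, in the sense that phi(x, c_s) holds on
    colour s, by an M-inconsistent sequence of c_s.  Taking the colourings of the set of
    functions from N to N by evaluation at 0, ..., N - 1 gives an N by N array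
    with M-inconsistent rows and consistent paths, against NTP2. *)

From Stdlib Require List.
Require Import Defs.
From mathcomp Require Import all_boot zify.
From mathcomp Require Import boolp classical_sets functions cardinality.

Set Implicit Arguments.
Unset Strict Implicit.
Unset Printing Implicit Defensive.

Local Open Scope classical_set_scope.

(** * Definable predicates and saturation *)

Section Definability.
Context (L : language) (C : structure L).

Fixpoint tren (V W : Type) (g : V -> W) (t : term L V) : term L W :=
  match t with
  | t_var x => t_var L (g x)
  | t_app F ts => t_app (fun i => tren g (ts i))
  end.

Fixpoint fren (V W : Type) (g : V -> W) (f : formula L V) : formula L W :=
  match f with
  | f_bot => f_bot
  | f_eq t u => f_eq (tren g t) (tren g u)
  | f_rel P ts => f_rel (fun i => tren g (ts i))
  | f_imp f1 f2 => f_imp (fren g f1) (fren g f2)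
  | f_all f1 => f_all (fren (omap g) f1)
  end.

Lemma eval_tren (V W : Type) (g : V -> W) (v : W -> C) (t : term L V) :
  eval v (tren g t) = eval (fun x => v (g x)) t.
Proof.
elim: t => //= F ts IH.
by congr finterp; apply/funext => i.
Qed.

Lemma sat_fren (V W : Type) (g : V -> W) (v : W -> C) (f : formula L V) :
  sat v (fren g f) <-> sat (fun x => v (g x)) f.
Proof.
elim: f W g v => {V} [V|V t u|V P ts|V f IHf h IHh|V f IH] W g v //=.
- by rewrite !eval_tren.
- by under eq_fun do rewrite eval_tren.
- by split=> H /IHf/H/IHh.
- have E x : (fun y => oapp v x (omap g y)) = oapp (fun y => v (g y)) x.
    by apply/funext => -[].
  by split=> H x; have := H x; rewrite IH E.
Qed.

(** Definability is semantic: predicates on assignments are written in the metalanguage and the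
    closure lemmas below supply formulas, so no syntax is handled by hand. *)
Definition dfn (V : Type) (P : (V -> C) -> Prop) :=
  exists f : formula L V, forall v, sat v f <-> P v.

Definition dfn2 (X Y : Type) (P : (X -> C) -> (Y -> C) -> Prop) :=
  dfn (fun v : X + Y -> C => P (fun x => v (inl x)) (fun y => v (inr y))).

Lemma dfn_ren (V W : Type) (g : V -> W) (P : (V -> C) -> Prop) :
  dfn P -> dfn (fun v : W -> C => P (fun x => v (g x))).
Proof. by move=> [f fP]; exists (fren g f) => v; rewrite sat_fren. Qed.

Lemma dfn2_ren (X Y W : Type) (g : X -> W) (h : Y -> W)
    (P : (X -> C) -> (Y -> C) -> Prop) :
  dfn2 P -> dfn (fun v : W -> C => P (fun x => v (g x)) (fun y => v (h y))).
Proof.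
exact: (dfn_ren (fun s => match s with inl x => g x | inr y => h y end)).
Qed.

Lemma dfn2_sat (X Y : Type) (f : formula L (X + Y)) :
  dfn2 (fun x y => sat (vcat x y) f).
Proof.
exists f => v; suff -> : vcat (fun x => v (inl x)) (fun y => v (inr y)) = v by [].
by apply/funext => -[].
Qed.

Lemma dfn_ext (V : Type) (P Q : (V -> C) -> Prop) :
  (forall v, P v <-> Q v) -> dfn P -> dfn Q.
Proof. by move=> PQ [f fP]; exists f => v; rewrite fP PQ. Qed.

Lemma dfn_eq (V : Type) (x y : V) : dfn (fun v => v x = v y).
Proof. by exists (f_eq (t_var L x) (t_var L y)). Qed.

Lemma dfn_imp (V : Type) (P Q : (V -> C) -> Prop) :
  dfn P -> dfn Q -> dfn (fun v => P v -> Q v).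
Proof. by move=> [f fP] [g gQ]; exists (f_imp f g) => v /=; rewrite fP gQ. Qed.

Lemma dfn_const (V : Type) (Q : Prop) : dfn (fun _ : V -> C => Q).
Proof.
have [q|q] := pselect Q; first by exists (f_imp f_bot f_bot) => v /=; split.
by exists f_bot => v /=; split.
Qed.

Lemma dfn_not (V : Type) (P : (V -> C) -> Prop) :
  dfn P -> dfn (fun v => ~ P v).
Proof. by move=> hP; apply: dfn_imp hP (dfn_const _ _). Qed.

Lemma dfn_and (V : Type) (P Q : (V -> C) -> Prop) :
  dfn P -> dfn Q -> dfn (fun v => P v /\ Q v).
Proof.
move=> hP hQ; apply: (dfn_ext _ (dfn_not (dfn_imp hP (dfn_not hQ)))) => v.
by split=> [/not_implyP[p /contrapT]//|[p q] /(_ p)].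
Qed.

Lemma dfn_In (I V : Type) (s : seq I) (P : I -> (V -> C) -> Prop) :
  (forall i, List.In i s -> dfn (P i)) ->
  dfn (fun v => forall i, List.In i s -> P i v).
Proof.
elim: s => [|i s IH] hP.
  by apply: dfn_ext (dfn_const _ True) => v; split.
apply: dfn_ext (dfn_and (hP i (or_introl erefl)) (IH _)) => [v|j js]; last first.
  by apply: hP; right.
by split=> [[Pi Ps] j [<-|/Ps]//|H]; split=> [|j js]; apply: H; [left|right].
Qed.

Lemma In_mem (I : eqType) (s : seq I) (i : I) : i \in s -> List.In i s.
Proof. by elim: s => //= j s IH; rewrite inE => /orP[/eqP->|/IH]; [left|right]. Qed.

Lemma dfn_forall (I : finType) (V : Type) (P : I -> (V -> C) -> Prop) :
  (forall i, dfn (P i)) -> dfn (fun v => forall i, P i v).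
Proof.
move=> hP; apply: dfn_ext (dfn_In (s := enum I) (fun i _ => hP i)) => v.
by split=> H i; first by apply: H; apply: In_mem; rewrite mem_enum.
Qed.

Lemma dfn_ex1 (V : Type) (P : (option V -> C) -> Prop) :
  dfn P -> dfn (fun v => exists x : C, P (oapp v x)).
Proof.
move=> [f fP]; exists (f_not (f_all (f_not f))) => v /=; split.
  by move=> /existsNP[x /contrapT /fP]; exists x.
by move=> [x /fP] H /(_ x).
Qed.

Lemma dfn_ex_ord (n : nat) (U : Type) (P : ('I_n -> C) -> (U -> C) -> Prop) :
  dfn2 P -> dfn (fun u => exists w, P w u).
Proof.
elim: n U P => [|n IH] U P hP.
  pose g (s : 'I_0 + U) : U :=
    match s with inl i => match notF (ltn_ord i) with end | inr u => u end.
  apply: dfn_ext (dfn_ren g hP) => u /=; split; first by eexists; eassumption.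
  move=> [w]; congr (P _ u); apply/funext => -[//].
pose Q (w : 'I_n -> C) (u : option U -> C) :=
  P (fun i => oapp w (u None) (unlift ord0 i)) (fun x => u (Some x)).
have hQ : dfn2 Q.
  pose g (i : 'I_n.+1) : 'I_n + option U := oapp inl (inr None) (unlift ord0 i).
  apply: dfn_ext (dfn2_ren g (fun x => inr (Some x)) hP) => v; rewrite /Q.
  suff -> : (fun x => v (g x)) = fun i =>
      oapp (fun x => v (inl x)) (v (inr None)) (unlift ord0 i) by [].
  by apply/funext => i; rewrite /g; case: unlift.
apply: dfn_ext (dfn_ex1 (IH _ _ hQ)) => u; split.
  by move=> [x [w H]]; eexists; exact: H.
move=> [w H]; exists (w ord0), (fun i => w (lift ord0 i)); rewrite /Q /=.
suff -> : (fun i => oapp (fun j => w (lift ord0 j)) (w ord0) (unlift ord0 i)) = w by [].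
by apply/funext => i; case: unliftP => [j|] -> /=.
Qed.

Lemma eval_rank (V : Type) (rk : V -> nat) (t : term L V) :
  exists N, forall v w : V -> C, (forall x, rk x < N -> v x = w x) ->
    eval v t = eval w t.
Proof.
elim: t => [x|F ts IH] /=; first by exists (rk x).+1 => v w; apply.
have [N HN] := choice IH.
exists (\max_i N i) => v w vw; congr finterp; apply/funext => i.
by apply: HN => x xN; apply: vw; apply: leq_trans xN (leq_bigmax i).
Qed.

(* [rk] is arbitrary so that the induction can assign rank 0 to the variable
   bound by a quantifier. *)
Lemma sat_rank (V : Type) (rk : V -> nat) (f : formula L V) :
  exists N, forall v w : V -> C, (forall x, rk x < N -> v x = w x) ->
    sat v f <-> sat w f.
Proof.
elim: f rk => {V} [V|V t u|V P ts|V f IHf h IHh|V f IH] rk /=.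
- by exists 0.
- have [[N HN] [M HM]] := (eval_rank rk t, eval_rank rk u).
  exists (maxn N M) => v w vw; rewrite (HN v w) ?(HM v w)// => x xN; apply: vw.
    by rewrite leq_max xN orbT.
  by rewrite leq_max xN.
- have [N HN] := choice (fun i => eval_rank rk (ts i)).
  exists (\max_i N i) => v w vw.
  suff -> : (fun i => eval v (ts i)) = fun i => eval w (ts i) by [].
  apply/funext => i; apply: HN => x xN; apply: vw.
  exact: leq_trans xN (leq_bigmax i).
- have [[N HN] [M HM]] := (IHf rk, IHh rk).
  exists (maxn N M) => v w vw; rewrite (HN v w) ?(HM v w)// => x xN; apply: vw.
    by rewrite leq_max xN orbT.
  by rewrite leq_max xN.
- have [N HN] := IH (oapp rk 0).
  exists N => v w vw; split=> H x; have := H x;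
    rewrite (HN (oapp v x) (oapp w x))// => -[y|]//=; exact: vw.
Qed.

(** By [sat_rank] a formula depends on finitely many coordinates of [w], so quantifying over an
    infinite tuple amounts to quantifying over [N.+1] coordinates; the successor makes [inord]
    available. *)
Lemma dfn_ex_nat (U : Type) (P : (nat -> C) -> (U -> C) -> Prop) :
  dfn2 P -> dfn (fun u => exists w, P w u).
Proof.
move=> hP; have [f fP] := hP.
pose rk (s : nat + U) := match s with inl i => i | inr _ => 0 end.
have [N HN] := sat_rank rk f.
have hQ : dfn2 (fun (w : 'I_N.+1 -> C) u => P (fun j => w (inord j)) u).
  exact: (dfn2_ren (fun j => inl (inord j)) inr hP).
apply: dfn_ext (dfn_ex_ord hQ) => u; split=> [[w Pw]|[w Pw]].
  by exists (fun j => w (inord j)).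
exists (fun i : 'I_N.+1 => w i).
apply/(fP (vcat (fun j => w (inord j : 'I_N.+1)) u)).
apply/(HN _ (vcat w u)); last exact/fP.
by case=> //= i iN; rewrite inordK// ltnW.
Qed.

Lemma inhab : inhabited C. Proof. exact: carrier_inhabited. Qed.

Definition unpick (V : countType) (w0 : C) (v : V -> C) (i : nat) : C :=
  oapp v w0 (unpickle i).

Lemma unpickK (V : countType) w0 (v : V -> C) :
  (fun x => unpick w0 v (pickle x)) = v.
Proof. by apply/funext => x; rewrite /unpick pickleK. Qed.

Lemma dfn_ex (V : countType) (U : Type) (P : (V -> C) -> (U -> C) -> Prop) :
  dfn2 P -> dfn (fun u => exists w, P w u).
Proof.
move=> hP; have [x0] := inhab.
have hQ : dfn2 (fun (w : nat -> C) u => P (fun x => w (pickle x)) u).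
  exact: (dfn2_ren (fun x => inl (pickle x)) inr hP).
apply: dfn_ext (dfn_ex_nat hQ) => u; split=> [[w Pw]|[w Pw]].
  by exists (fun x => w (pickle x)).
by exists (unpick x0 w); rewrite unpickK.
Qed.

Lemma finite_set_In (T : Type) (q : set T) :
  finite_set q -> exists s : seq T, forall x, q x -> List.In x s.
Proof.
elim/Pchoice: T => T in q *; move=> /finite_seqP[s ->]; exists s => x.
exact: In_mem.
Qed.

(** * Realization of types in countably many variables *)

Context (K : Type).
Hypotheses (Kbig : card_lt K [set: formula L nat]) (Csat : saturated K C).

Lemma countable_card_lt (A : set C) : countable A -> card_lt K A.
Proof.
move=> cA KA; apply: Kbig; apply: (card_le_trans KA); apply: (card_le_trans cA).
have /injfunPex[f] : exists2 f : nat -> formula L nat,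
    set_fun [set: nat] [set: formula L nat] f & set_inj [set: nat] f.
  by exists (fun i => f_eq (t_var L i) (t_var L i)) => // i j _ _ [].
exact: inj_card_le f.
Qed.

(** Saturation concerns types in finitely many variables, so an infinite tuple is built one
    coordinate at a time. Here [x] realizes the type saying that each finite part of [P] is solvable
    with the first [i] coordinates as in [v] and the next one equal to [x]. *)
Lemma realize_step (U : countType) (u : U -> C) (P : set ((nat -> C) -> (U -> C) -> Prop))
    (i : nat) (v : nat -> C) :
  (forall Q, P Q -> dfn2 Q) ->
  (forall l, (forall Q, List.In Q l -> P Q) ->
    exists w, (forall j, j < i -> w j = v j) /\ forall Q, List.In Q l -> Q w u) ->
  exists x, forall l, (forall Q, List.In Q l -> P Q) ->
    exists w, [/\ forall j, j < i -> w j = v j, w i = x &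
                 forall Q, List.In Q l -> Q w u].
Proof.
move=> dP finP.
pose A : set C := range (fun s : nat + U => vcat v u s).
have cA : card_lt K A.
  by apply: countable_card_lt; apply: (card_le_trans (card_image_le _ _)); apply: countableP.
pose el (s : nat + U) : A := SigSub (mem_set (ex_intro2 _ _ s I erefl : A (vcat v u s))).
pose Ql l x := exists w, [/\ forall j, j < i -> w j = v j, w i = x &
  forall Q, List.In Q l -> Q w u].
pose p : set (formula L ('I_1 + A)) := [set f | exists l, (forall Q, List.In Q l -> P Q) /\
  forall x : 'I_1 -> C, sat (vcat x val) f <-> Ql l (x ord0)].
have [q fq qp|c cp] := Csat (p := p) cA.
  have [s qs] := finite_set_In fq.
  (* The finitely many lists behind [q] are concatenated into one list whose solvability implies
     every formula of [q]. *)
  suff [l [lP Hl]] : exists l, (forall Q, List.In Q l -> P Q) /\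
      forall f, p f -> List.In f s -> forall x : 'I_1 -> C, Ql l (x ord0) -> sat (vcat x val) f.
    have [w [wv wl]] := finP l lP.
    by exists (fun=> w i) => f qf; apply: Hl; [exact: qp|exact: qs|exists w].
  elim: s {qs} => [|f s [l [lP Hl]]]; first by exists [::].
  have [[l' [l'P Hf]]|npf] := pselect (p f); last first.
    by exists l; split=> // f' pf' [ff'|]; [rewrite ff' in npf|exact: Hl].
  exists (l ++ l'); split=> [Q /List.in_app_iff[/lP|/l'P]//|f' pf' [<-|fs] x [w [wv wi wl]]].
    by apply/Hf; exists w; split=> // Q Ql'; apply: wl; apply/List.in_app_iff; right.
  by apply: Hl => //; exists w; split=> // Q Ql'; apply: wl; apply/List.in_app_iff; left.
exists (c ord0) => l lP.
suff [f Hf] : exists f : formula L ('I_1 + A), forall x : 'I_1 -> C,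
    sat (vcat x val) f <-> Ql l (x ord0) by apply/Hf/cp; exists l.
(* Coordinates below [i] become parameters, coordinate [i] is the variable of the type, and the
   later ones are quantified. *)
pose g (j : nat) : nat + ('I_1 + A) :=
  if j < i then inr (inr (el (inl j))) else if j == i then inr (inl ord0) else inl j.
have hQ Q : List.In Q l -> dfn2 (fun (w : nat -> C) (y : 'I_1 + A -> C) =>
    Q (fun j => vcat w y (g j)) (fun x => y (inr (el (inr x))))).
  move=> /lP/dP dQ.
  apply: dfn_ext (dfn2_ren g (fun x => inr (inr (el (inr x)))) dQ) => z.
  suff -> : (fun x => z (g x)) = fun j : nat =>
     vcat (fun x => z (inl x)) (fun y => z (inr y)) (g j) by [].
  by apply/funext => j; case: (g j).
have [f Hf] := @dfn_ex_nat _ (fun w y => forall Q, List.In Q l ->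
  Q (fun j => vcat w y (g j)) (fun x => y (inr (el (inr x))))) (dfn_In hQ).
exists f => x; rewrite Hf; split=> [[w Hw]|[w [wv wi wl]]].
  exists (fun j => vcat w (vcat x val) (g j)); split=> [j ji||Q /Hw//].
    by rewrite /g ji.
  by rewrite /g ltnn eqxx.
exists w => Q /wl; congr (Q _ _); apply/funext => j; rewrite /g.
by case: ltnP => [/wv //|_]; case: eqP => [->|].
Qed.

(** Iterating [realize_step] preserves finite satisfiability. Each condition sees finitely many
    coordinates, so the limit of the chosen values satisfies all of them. *)
Lemma realize_nat (U : countType) (u : U -> C) (P : set ((nat -> C) -> (U -> C) -> Prop)) :
  (forall Q, P Q -> dfn2 Q) ->
  (forall l, (forall Q, List.In Q l -> P Q) -> exists w, forall Q, List.In Q l -> Q w u) ->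
  exists w, forall Q, P Q -> Q w u.
Proof.
move=> dP finP.
pose ok i (v : nat -> C) := forall l, (forall Q, List.In Q l -> P Q) ->
    exists w, (forall j, j < i -> w j = v j) /\ forall Q, List.In Q l -> Q w u.
have step i v : exists v', ok i v -> ok i.+1 v' /\ forall j, j < i -> v' j = v j.
  have [okv|] := pselect (ok i v); last by exists v.
  have [x Hx] := realize_step dP okv.
  exists (fun j => if j == i then x else v j) => _; split=> [l /Hx[w [wv wi wl]]|j ji].
    exists w; split=> // j; rewrite ltnS leq_eqVlt; case: eqP => [->//|_ /=]; exact: wv.
  by rewrite ltn_eqF.
have [nxt Hn] := choice (fun iv : nat * (nat -> C) => step iv.1 iv.2).
have [x0] := inhab.
pose V := fix V i := if i is j.+1 then nxt (j, V j) else fun=> x0.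
have okV i : ok i (V i).
  elim: i => [l /finP[w ?]|i IH]; first by exists w.
  by have [] := Hn (i, V i) IH.
have VE j i : j < i -> V i j = V j.+1 j.
  elim: i => // i IH; rewrite ltnS leq_eqVlt => /orP[/eqP->//|ji].
  by have [_ /(_ _ ji) /= ->] := Hn (i, V i) (okV i); exact: IH.
exists (fun j => V j.+1 j) => Q PQ.
have [f Hf] := dP _ PQ.
have [N HN] := sat_rank (fun s => match s with inl i => i | inr _ => 0 end) f.
have [|w [wv wQ]] := okV N [:: Q]; first by move=> Q' [<-|].
have /(Hf (vcat w u)) Hw : Q w u by apply: wQ; left.
apply/(Hf (vcat (fun j => V j.+1 j) u)); apply/(HN _ (vcat w u)) => // -[j|]//= jN.
by rewrite wv// VE.
Qed.

Lemma realize (V U : countType) (u : U -> C) (P : set ((V -> C) -> (U -> C) -> Prop)) :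
  (forall Q, P Q -> dfn2 Q) ->
  (forall l, (forall Q, List.In Q l -> P Q) -> exists v, forall Q, List.In Q l -> Q v u) ->
  exists v, forall Q, P Q -> Q v u.
Proof.
move=> dP finP; have [x0] := inhab.
pose lift Q (w : nat -> C) (u : U -> C) : Prop := Q (fun x : V => w (pickle x)) u.
have [|l lP|w Hw] := @realize_nat U u [set lift Q | Q in P].
- by move=> _ [Q /dP dQ <-]; exact: (dfn2_ren (fun x => inl (pickle x)) inr dQ).
- have [l' [l'P Hl']] : exists l', (forall Q, List.In Q l' -> P Q) /\
      forall Q, List.In Q l -> exists2 Q', List.In Q' l' & Q = lift Q'.
    elim: l lP => [|Q l IH] lP; first by exists [::].
    have [Q' Ql|l' [l'P Hl']] := IH; first by apply: lP; right.
    have [Q' PQ' E] := lP Q (or_introl erefl).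
    exists (Q' :: l'); split=> [R [<-//|/l'P//]|R [<-|/Hl'[R' R'l ->]]].
      by exists Q' => //; left.
    by exists R' => //; right.
  have [v Hv] := finP l' l'P.
  by exists (unpick x0 v) => Q /Hl'[Q' /Hv H ->]; rewrite /lift unpickK.
- by exists (fun x => w (pickle x)) => Q PQ; apply: (Hw (lift Q)); exists Q.
Qed.

Lemma realize_lim (V U : countType) (u : U -> C) (v : nat -> V -> C)
    (P : set ((V -> C) -> (U -> C) -> Prop)) :
  (forall Q, P Q -> dfn2 Q) ->
  (forall Q, P Q -> exists N, forall M, N <= M -> Q (v M) u) ->
  exists w, forall Q, P Q -> Q w u.
Proof.
move=> dP ev; apply: realize => // l lP.
suff [N HN] : exists N, forall M, N <= M -> forall Q, List.In Q l -> Q (v M) u.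
  by exists (v N); apply: HN.
elim: l lP => [|Q l IH] lP; first by exists 0.
have [|N HN] := IH; first by move=> Q' Ql; apply: lP; right.
have [N' HN'] := ev Q (lP _ (or_introl erefl)).
exists (maxn N N') => M; rewrite geq_max => /andP[NM N'M] R [<-|]; first exact: HN'.
exact: HN.
Qed.

(** This replaces conjugation by an automorphism: solvability of a finite part of [P] is a definable
    property of [u], hence passes to [u'], and saturation does the rest. *)
Lemma transfer (V U : countType) (u u' : U -> C) (P : set ((V -> C) -> (U -> C) -> Prop)) :
  (forall Q, P Q -> dfn2 Q) ->
  (forall Q : (U -> C) -> Prop, dfn Q -> Q u -> Q u') ->
  (exists v, forall Q, P Q -> Q v u) -> exists v, forall Q, P Q -> Q v u'.
Proof.
move=> dP uu' [v Hv]; apply: realize => // l lP.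
apply: (uu' (fun y => exists v, forall Q, List.In Q l -> Q v y)).
  by apply: dfn_ex; apply: (dfn_In (P := fun Q v => Q _ _)) => Q /lP/dP.
by exists v => Q /lP/Hv.
Qed.

End Definability.

(** * Finite and infinite combinatorics *)

Lemma fiber_pigeonhole (T : finType) (J K : nat) (h : 'I_K -> T) :
  #|T| * J < K -> exists t, J <= #|[pred x | h x == t]|.
Proof.
move=> JK; apply: contrapT => /forallNP H.
have : \sum_(t : T) #|[pred x | h x == t]| <= \sum_(t : T) J.
  by apply: leq_sum => t _; apply: ltnW; rewrite ltnNge; apply/negP/H.
rewrite sum_nat_const leqNgt => /negP; apply; apply: (leq_trans JK).
rewrite -[X in X <= _]card_ord -sum1_card (partition_big h predT)//=.
by apply: leq_sum => t _; rewrite -sum1_card.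
Qed.

(* The first coordinate ranges over so many values that, once the colour
   pattern along it is constant on a subgrid of the others, it can be
   thinned by pigeonhole. *)
Lemma grid_pigeonhole (n J : nat) (T : finType) :
  exists B, forall col : ('I_n -> nat) -> T, exists F : 'I_n -> 'I_J -> nat,
    [/\ forall i, injective (F i), forall i j, F i j < B &
        exists t, forall z : 'I_n -> 'I_J, col (fun i => F i (z i)) = t].
Proof.
elim: n T => [|n IH] T.
  exists 0 => col; exists (fun _ _ => 0); split=> [[]//|[]//|].
  by exists (col (fun=> 0)) => z; congr col; apply/funext => -[].
pose K := (#|T| * J).+1.
have [B HB] := IH {ffun 'I_K -> T}.
exists (maxn B K) => col.
pose cns x (y : 'I_n -> nat) (i : 'I_n.+1) := oapp y x (unlift ord0 i).
have [F [Finj FB [h Fh]]] := HB (fun y => [ffun x : 'I_K => col (cns x y)]).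
have [t tJ] := fiber_pigeonhole (fun x => h x) (ltnSn (#|T| * J)).
pose F0 (j : 'I_J) : nat := enum_val (widen_ord tJ j).
exists (fun i => oapp F F0 (unlift ord0 i)); split=> [i|i j|].
- case: unliftP => [k|] _ /=; first exact: Finj.
  by move=> j j' /val_inj/enum_val_inj/(congr1 val)/= /val_inj.
- case: unliftP => [k|] _ /=; first by rewrite leq_max FB.
  by rewrite leq_max ltn_ord orbT.
- exists t => z; pose x : 'I_K := enum_val (widen_ord tJ (z ord0)).
  have xt : h x = t by apply/eqP; exact: (enum_valP (widen_ord tJ (z ord0))).
  rewrite -xt -(Fh (fun i => z (lift ord0 i))) ffunE; congr col.
  by apply/funext => i; rewrite /cns; case: unliftP => [k|] ->.
Qed.

(** * Ramsey's theorem *)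

Definition smono (g : nat -> nat) := {homo g : i j / i < j}.

Lemma smono_comp g h : smono g -> smono h -> smono (g \o h).
Proof. by move=> hg hh i j ij; apply: hg; apply: hh. Qed.

Lemma smonoS g : (forall i, g i < g i.+1) -> smono g.
Proof. by move=> H; apply: homo_ltn => //; exact: ltn_trans. Qed.

Lemma unbounded_smono (P : nat -> Prop) :
  (forall i, exists2 j, i < j & P j) -> exists2 g, smono g & forall i, P (g i).
Proof.
move=> H; have /choice[f Hf] : forall i, exists j, i < j /\ P j.
  by move=> i; have [j] := H i; exists j.
pose g := fix g i := if i is j.+1 then f (g j) else f 0.
exists g; first by apply: smonoS => i /=; have [] := Hf (g i).
by case=> [|i] /=; [have [] := Hf 0|have [] := Hf (g i)].
Qed.

(** Nested subsequences are chosen so that the colour of a tuple from the diagonal sequence depends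
    only on its first entry; one colour of first entries is then selected. *)
Lemma ramsey_seq (r : nat) (G : seq nat -> Prop) :
  exists2 g, smono g &
    (forall s, size s = r -> sorted ltn s -> G (map g s)) \/
    (forall s, size s = r -> sorted ltn s -> ~ G (map g s)).
Proof.
elim: r G => [|r IH] G.
  by exists id => //; have [G0|G0] := pselect (G [::]); [left|right] => -[].
pose good x (h : nat -> nat) :=
  (forall s, size s = r -> sorted ltn s -> G (x :: map h s)) \/
  (forall s, size s = r -> sorted ltn s -> ~ G (x :: map h s)).
have step (h : nat -> nat) : exists g, smono g /\ good (h 0) (h \o S \o g).
  have [g hg Hg] := IH (fun s => G (h 0 :: map (h \o S) s)).
  exists g; split=> //; rewrite /good.
  have E s : map (h \o S \o g) s = map (h \o S) (map g s) by rewrite -map_comp.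
  by case: Hg => Hg; [left|right] => s; rewrite E; exact: Hg.
have [nx Hnx] := choice step.
(* [H i.+1] is a subsequence of [H i] beyond its first entry [x i], homogeneous for the tuples
   starting with [x i]. *)
pose H := fix H i := if i is j.+1 then H j \o S \o nx (H j) else id.
have mH i : smono (H i).
  elim: i => //= i IHi; apply: smono_comp (Hnx _).1.
  by apply: smono_comp => // j k; rewrite ltnS.
pose x i := H i 0.
have sub i j : exists2 g, smono g & forall l, H (i + j) l = H i (g l).
  elim: j => [|j [g hg Hg]]; first by exists id => //; rewrite addn0.
  rewrite addnS; exists (g \o S \o nx (H (i + j))) => [|l]; last by rewrite /= Hg.
  by apply: smono_comp (Hnx _).1; apply: smono_comp => // k l; rewrite ltnS.
have xsub i j : i < j -> exists l, x j = H i.+1 l.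
  by move=> /subnKC <-; have [g _ Hg] := sub i.+1 (j - i.+1); exists (g 0); exact: Hg.
have mx : smono x.
  apply: smonoS => i; have [_ _] := Hnx (H i); rewrite /x /=.
  by apply: mH.
have col i : good (x i) (H i.+1) by have [] := Hnx (H i).
have colx i (s : seq nat) : size s = r -> sorted ltn s ->
    all (ltn i) s -> exists2 s', size s' = r /\ sorted ltn s' & map x s = map (H i.+1) s'.
  move=> sr ss si.
  have /choice[f Hf] : forall j, exists l, i < j -> x j = H i.+1 l.
    move=> j; case: (ltnP i j) => [/xsub[l ->]|_]; [by exists l|by exists 0].
  exists (map f s); last first.
    rewrite -map_comp; apply/eq_in_map => j js; apply: Hf; exact: (allP si).
  rewrite size_map; split=> //; rewrite sorted_map.
  apply: (sub_in_sorted (P := ltn i) (e := ltn)) ss => // j k ij ik jk /=.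
  have := mx _ _ jk; rewrite (Hf j)// (Hf k)//.
  by rewrite ltnNge; apply: contraNT; rewrite -leqNgt => kj; exact: (ltnW_homo (mH i.+1)).
pose up i := forall s, size s = r -> sorted ltn s -> G (x i :: map (H i.+1) s).
have fin (P : nat -> Prop) (b : Prop) : (forall i, exists2 j, i < j & P j) ->
    (forall i s, P i -> size s = r -> sorted ltn s ->
       (b <-> G (x i :: map (H i.+1) s))) ->
    exists2 g, smono g & forall s, size s = r.+1 -> sorted ltn s -> (b <-> G (map g s)).
  move=> Pinf HP; have [g hg Pg] := unbounded_smono Pinf.
  exists (x \o g) => [|[//|i s] [sr] ss]; first exact: smono_comp.
  have [||| s' [s'r s's] E] := @colx (g i) (map g s); rewrite ?size_map//.
  - rewrite sorted_map; apply: sub_sorted (path_sorted ss) => j k; exact: hg.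
  - rewrite all_map; have := order_path_min ltn_trans ss.
    by apply: sub_all => j; exact: hg.
  by rewrite /= map_comp E; apply: HP.
(* Either infinitely many first entries have the positive colour, or all entries beyond some [i0]
   have the negative one. *)
have [inf|/existsNP[i0 Hi0]] := pselect (forall i, exists2 j, i < j & up j).
  have [|g hg Hg] := fin up True inf; first by move=> i s ui sr ss; split=> // _; exact: ui.
  by exists g => //; left=> s sr ss; apply/Hg.
have [||g hg Hg] := fin (fun i => i0 < i) False.
- move=> i; exists (maxn i0 i).+1 => /=; rewrite ltnS ?leq_maxr ?leq_maxl//.
- move=> i s i0i sr ss; split=> // Gs; case: (col i) => [ui|/(_ s sr ss)//].
  by exfalso; apply: Hi0; exists i.
- by exists g => //; right=> s sr ss; apply/(Hg s sr ss).
Qed.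

Lemma ramsey (r : nat) (G : ('I_r -> nat) -> Prop) :
  exists2 g, smono g & forall s t, increasing s -> increasing t ->
    G (g \o s) -> G (g \o t).
Proof.
have [g hg Hg] := ramsey_seq r (fun l => G (fun i => nth 0 l i)).
exists g => //.
have E (s : 'I_r -> nat) : increasing s ->
    exists l, [/\ size l = r, sorted ltn l & (fun i : 'I_r => nth 0 (map g l) i) = g \o s].
  move=> hs; exists [seq s i | i <- enum 'I_r].
  rewrite size_map size_enum_ord; split=> //; last first.
    apply/funext => i.
    by rewrite -map_comp (nth_map i) ?size_enum_ord// nth_ord_enum.
  rewrite sorted_map.
  have : sorted ltn (map val (enum 'I_r)) by rewrite val_enum_ord iota_ltn_sorted.
  by rewrite sorted_map; apply: sub_sorted => i j; exact: hs.
move=> s t /E[l [lr ls <-]] /E[k [kr ks <-]].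
by case: Hg => H; [move=> _; exact: H|move=> /H []].
Qed.

Lemma sort_injective (k : nat) (s : 'I_k -> nat) : injective s ->
  exists2 t : 'I_k -> nat, increasing t & forall i, exists j, t i = s j.
Proof.
move=> si; pose l := sort leq [seq s i | i <- enum 'I_k].
have sl : size l = k by rewrite size_sort size_map size_enum_ord.
have ul : uniq l by rewrite sort_uniq map_inj_uniq ?enum_uniq.
have ol : sorted ltn l by rewrite ltn_sorted_uniq_leq ul sort_sorted//; exact: leq_total.
exists (fun i => nth 0 l i) => [i j ij|i].
  by apply: (sorted_ltn_nth ltn_trans) => //; rewrite inE sl.
have : nth 0 l i \in l by rewrite mem_nth// sl.
by rewrite mem_sort => /mapP[j _ ->]; exists j.
Qed.

Lemma increasing_injective (k : nat) (s : 'I_k -> nat) : increasing s -> injective s.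
Proof.
move=> hs i j ij; apply/val_inj; case: (ltngtP i j) => // /hs; by rewrite ij ltnn.
Qed.

Lemma smono_increasing (k : nat) g (s : 'I_k -> nat) :
  smono g -> increasing s -> increasing (g \o s).
Proof. by move=> hg hs i j ij; apply: hg; apply: hs. Qed.

(** * Indiscernible sequences, resilience and NTP2 *)

Section Sequences.
Context (L : language) (C : structure L).

(** Together with [kinconsistent], the counterpart of [consistent] and [k_inconsistent] for
    predicates, with arbitrary types of variables and indices. *)
Definition jointly_sat (X Y I : Type) (P : (X -> C) -> (Y -> C) -> Prop) (y : I -> Y -> C) :=
  exists x, forall i, P x (y i).

Definition kinconsistent (X Y I : Type) (P : (X -> C) -> (Y -> C) -> Prop) (k : nat)
    (y : I -> Y -> C) :=
  forall s : 'I_k -> I, injective s -> ~ jointly_sat P (fun t => y (s t)).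

Definition dfnS (r : nat) (F : Type) (G : ('I_r -> F -> C) -> Prop) :=
  dfn (fun v : 'I_r * F -> C => G (fun i x => v (i, x))).

Lemma dfnS_ren (r : nat) (F V : Type) (G : ('I_r -> F -> C) -> Prop) (g : 'I_r -> F -> V) :
  dfnS G -> dfn (fun v : V -> C => G (fun i x => v (g i x))).
Proof. exact: (dfn_ren (fun p => g p.1 p.2)). Qed.

Lemma dfn_jointly_sat (X : countType) (I : finType) (Y V : Type)
    (P : (X -> C) -> (Y -> C) -> Prop) (g : I -> Y -> V) :
  dfn2 P -> dfn (fun v : V -> C => jointly_sat P (fun i y => v (g i y))).
Proof.
move=> hP; apply: (@dfn_ex _ _ _ _ (fun x v => forall i, P x (fun y => v (g i y)))).
by apply: dfn_forall => i; exact: (dfn2_ren inl (fun y => inr (g i y)) hP).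
Qed.

Lemma dfn_kinconsistent (X : countType) (I : finType) (Y V : Type) (k : nat)
    (P : (X -> C) -> (Y -> C) -> Prop) (g : I -> Y -> V) :
  dfn2 P -> dfn (fun v : V -> C => kinconsistent P k (fun i y => v (g i y))).
Proof.
move=> hP.
have /dfn_ext : forall v : V -> C, (forall s : {ffun 'I_k -> I}, injective s ->
    ~ jointly_sat P (fun t y => v (g (s t) y))) <-> kinconsistent P k (fun i y => v (g i y)).
  move=> v; split=> H s si; last exact: H.
  have := H (finfun s); rewrite (_ : fun_of_fin (finfun s) = s); first exact.
  by apply/funext => t; rewrite ffunE.
apply; apply: dfn_forall => s; apply: dfn_imp (dfn_const _ _ _) _.
by apply: dfn_not; apply: dfn_jointly_sat.
Qed.

Definition indisc (F : Type) (a : nat -> F -> C) :=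
  forall r (G : ('I_r -> F -> C) -> Prop) s t, dfnS G -> increasing s -> increasing t ->
    G (fun i => a (s i)) -> G (fun i => a (t i)).

(* [u] satisfies the Ehrenfeucht-Mostowski type of [a]. *)
Definition EMle (F : Type) (a u : nat -> F -> C) :=
  forall r (G : ('I_r -> F -> C) -> Prop), dfnS G ->
    (forall s, increasing s -> G (fun i => a (s i))) ->
    forall s, increasing s -> G (fun i => u (s i)).

(** On increasing tuples of an indiscernible [a], either [G] always holds or its negation does, and
    [u] and [w] both inherit the outcome. *)
Lemma EMle_transfer (F : Type) (a u w : nat -> F -> C) r
    (G : ('I_r -> F -> C) -> Prop) s t : indisc a -> EMle a u -> EMle a w ->
  dfnS G -> increasing s -> increasing t ->
  G (fun i => u (s i)) -> G (fun i => w (t i)).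
Proof.
move=> ia au aw dG hs ht Gs.
have [[s0 [hs0 Gs0]]|H] := pselect (exists s, increasing s /\ G (fun i => a (s i))).
  by apply: aw => // t' ht'; apply: ia Gs0.
exfalso; have := au _ (fun y => ~ G y) (dfn_not dG) _ s hs; apply=> // s' hs' Gs'.
by apply: H; exists s'.
Qed.

Lemma EMle_indisc (F : Type) (a u : nat -> F -> C) : EMle a u -> indisc a -> indisc u.
Proof. by move=> au ia r G s t dG hs ht; apply: (EMle_transfer ia au au). Qed.

Lemma indiscernible_over_indisc (A : set C) (m : nat) (a : nat -> 'I_m -> C) :
  indiscernible_over A a -> indisc a.
Proof.
move=> ia r G s t [f Hf] hs ht.
have Gf s' : G (fun i => a (s' i)) <->
    sat (vcat (fun p => a (s' p.1) p.2) (val : A -> C)) (fren inl f).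
  by rewrite sat_fren; apply: iff_sym; exact: (Hf (fun p => a (s' p.1) p.2)).
by move=> /Gf H; apply/Gf/(ia _ _ s t).
Qed.

Lemma indisc_indiscernible (F : finType) (a : nat -> F -> C) :
  indisc a -> indiscernible (fun i (t : 'I_#|F|) => a i (enum_val t)).
Proof.
move=> ia r f s t hs ht.
pose G (y : 'I_r -> F -> C) :=
  sat (vcat (fun p => y p.1 (enum_val p.2)) (val : (@set0 C) -> C)) f.
have dG : dfnS G.
  pose g (q : 'I_r * 'I_#|F| + @set0 C) : 'I_r * F :=
    match q with inl p => (p.1, enum_val p.2) | inr x => False_rect _ (set_mem (valP x)) end.
  exists (fren g f) => v; rewrite sat_fren /G.
  suff -> : (fun x => v (g x)) = vcat (fun p => v (p.1, enum_val p.2)) val by [].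
  by apply/funext => -[//|x]; case: (set_mem (valP x)).
by split; [exact: (ia r G s t)|exact: (ia r G t s)].
Qed.

Lemma consistent_enum (X F : finType) (P : (X -> C) -> (F -> C) -> Prop) : dfn2 P ->
  exists phi : formula L ('I_#|X| + 'I_#|F|), forall (I : Type) (b : I -> F -> C),
    consistent phi (fun i t => b i (enum_val t)) <-> jointly_sat P b.
Proof.
move=> hP; have [f Hf] := dfn2_ren (fun x => inl (enum_rank x)) (fun y => inr (enum_rank y)) hP.
exists f => I b.
have E i : (fun y => b i (enum_val (enum_rank y))) = b i.
  by apply/funext => y; rewrite enum_rankK.
split=> [[c Hc]|[x Hx]].
  exists (fun x => c (enum_rank x)) => i; have /Hf/= := Hc i.
  by rewrite E.
exists (fun t => x (enum_val t)) => i; apply/Hf => /=; rewrite E.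
rewrite (_ : (fun y => _) = x)//; by apply/funext => y; rewrite enum_rankK.
Qed.

Lemma insert_after_comp (X Y : Type) (h : X -> Y) (a b : nat -> X) k i :
  insert_after (fun i => h (a i)) (fun i => h (b i)) k i = h (insert_after a b k i).
Proof. by rewrite /insert_after; case: ifP => // _; case: ifP. Qed.

(** Thinning both sequences and then inserting gives a subsequence of an insertion into the original
    one, so insertion conditions survive an application of Ramsey's theorem. *)
Lemma insert_after_smono (X : Type) (a b : nat -> X) g k : smono g ->
  exists2 h, smono h & forall i,
    insert_after (fun i => a (g i)) (fun i => b (g i)) k i = insert_after a b (g k) (h i).
Proof.
move=> hg; have gle := leq_mono (f := g) hg.
(* The inserted element sits right after position [g k], which shifts all later positions by one. *)
exists (fun i => if i <= k then g i else if i == k.+1 then (g k).+1 else (g i.-1).+1).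
  apply: smonoS => i; case: (ltngtP i k) => [ik|ik|->].
  - exact: hg.
  - rewrite eqSS (gtn_eqF ik) /=.
    case: eqP => [->|_] /=; rewrite ltnS; first exact: hg.
    by apply: hg; case: i ik.
  - by rewrite eqxx ltnS.
move=> i; rewrite /insert_after.
case: (leqP i k) => [ik|ki]; first by rewrite gle ik.
case: (i =P k.+1) => [_|/eqP ne]; first by rewrite ltnn eqxx.
have ki' : k < i.-1.
  by case: i ki ne => // i; rewrite ltnS eqSS [k < _]ltn_neqAle eq_sym => -> ->.
by rewrite ltnNge ltnW ?hg//= eqSS gtn_eqF ?hg.
Qed.

Lemma resilient_fin (X F : finType) (P : (X -> C) -> (F -> C) -> Prop)
    (a b : nat -> F -> C) : omega_resilient C -> dfn2 P ->
  indisc a -> indisc b -> (forall k, indisc (insert_after a b k)) ->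
  jointly_sat P a -> jointly_sat P b.
Proof.
move=> res hP ia ib iab; have [phi Hphi] := consistent_enum hP.
move=> /Hphi H; apply/Hphi; apply: res H; try exact: indisc_indiscernible.
move=> k; have := indisc_indiscernible (iab k).
congr (indiscernible _); apply/funext => i; symmetry.
exact: (insert_after_comp (fun (y : F -> C) (t : 'I_#|F|) => y (enum_val t))).
Qed.

Lemma ntp2_fin (X Y : finType) (P : (X -> C) -> (Y -> C) -> Prop) (k : nat)
    (a : nat -> nat -> Y -> C) : NTP2 C -> dfn2 P ->
  (forall eta : nat -> nat, jointly_sat P (fun i => a i (eta i))) ->
  ~ (forall i, kinconsistent P k (a i)).
Proof.
move=> ntp hP Ha Hk; have [phi Hphi] := consistent_enum hP; apply: ntp.
exists #|X|, #|Y|, phi, (fun i j (t : 'I_#|Y|) => a i j (enum_val t)), k; split=> [eta|i s si].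
  exact/(Hphi _ (fun i => a i (eta i))).
by move=> /(Hphi _ (fun t => a i (s t))); exact: Hk.
Qed.

(** * Compactness combined with NTP2 and resilience *)

Context (K : Type).
Hypotheses (Kbig : card_lt K [set: formula L nat]) (Csat : saturated K C).
Hypotheses (ntp : NTP2 C) (res : omega_resilient C).

Lemma jointly_sat_compact (X F : countType) (P : (X -> C) -> (F -> C) -> Prop)
    (y : nat -> F -> C) : dfn2 P ->
  (forall M, jointly_sat P (fun i : 'I_M => y i)) -> jointly_sat P y.
Proof.
move=> hP Hy; have [x Hx] := choice Hy.
have [|_ [i _ <-]|w Hw] := @realize_lim _ _ _ Kbig Csat X (nat * F)%type
    (fun p => y p.1 p.2) x (range (fun i x u => P x (fun t => u (i, t)))).
- by move=> _ [i _ <-]; exact: (dfn2_ren inl (fun t => inr (i, t)) hP).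
- by exists i.+1 => M iM; exact: (Hx M (Ordinal iM)).
by exists w => i; apply: (Hw (fun x u => P x (fun t => u (i, t)))); exists i.
Qed.

(** If square arrays of every size existed, a limit of them would be an infinite array violating
    NTP2. *)
Lemma ntp2_square (X Y : finType) (P : (X -> C) -> (Y -> C) -> Prop) (k : nat) :
  dfn2 P -> exists N, ~ exists a : 'I_N.+1 -> 'I_N.+1 -> Y -> C,
    (forall eta, jointly_sat P (fun i => a i (eta i))) /\ forall i, kinconsistent P k (a i).
Proof.
move=> hP; apply: contrapT => /forallNP H.
have /choice[a Ha] : forall N, exists a : nat -> nat -> Y -> C,
    (forall eta : nat -> nat, (forall i, eta i <= N) ->
       jointly_sat P (fun i : 'I_N.+1 => a i (eta i))) /\
    (forall (i : 'I_N.+1) (s : 'I_k -> nat), injective s -> (forall t, s t <= N) ->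
       ~ jointly_sat P (fun t => a i (s t))).
  move=> N; have [a [Ha Hk]] : exists a : 'I_N.+1 -> 'I_N.+1 -> Y -> C,
      (forall eta, jointly_sat P (fun i => a i (eta i))) /\ forall i, kinconsistent P k (a i).
    by apply: contrapT; exact: H.
  exists (fun i j => a (inord i) (inord j)); split=> [eta He|i s si sN].
    have [x Hx] := Ha (fun i => inord (eta i)).
    by exists x => i; have := Hx (inord i); rewrite inordK.
  apply: Hk => t t' /(congr1 val) /=; by rewrite !inordK ?ltnS// => /si.
pose S1 : set ((nat * nat * Y -> C) -> (void -> C) -> Prop) :=
  [set Q | exists M (eta : nat -> nat),
     Q = fun v _ => jointly_sat P (fun (i : 'I_M) y => v (nat_of_ord i, eta i, y))].
pose S2 : set ((nat * nat * Y -> C) -> (void -> C) -> Prop) :=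
  [set Q | exists i (s : 'I_k -> nat), injective s /\
     Q = fun v _ => ~ jointly_sat P (fun t y => v (i, s t, y))].
have [|Q|w Hw] := @realize_lim _ _ _ Kbig Csat (nat * nat * Y)%type void (@of_void C)
    (fun N p => a N p.1.1 p.1.2 p.2) (S1 `|` S2).
- move=> _ [[M [eta ->]]|[i [s [_ ->]]]].
    exact: (dfn_jointly_sat (fun (i : 'I_M) y => inl (nat_of_ord i, eta i, y))).
  by apply: dfn_not; exact: (dfn_jointly_sat (fun t y => inl (i, s t, y))).
- move=> [[M [eta ->]]|[i [s [si ->]]]].
    exists (maxn M (\max_(i < M) eta i)) => N; rewrite geq_max => /andP[MN eN].
    have [|x Hx] := (Ha N).1 (fun i => if i < M then eta i else 0).
      by move=> i; case: ifP => // iM; apply: leq_trans eN; exact: (leq_bigmax (Ordinal iM)).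
    have iN (i : 'I_M) : i < N.+1 by rewrite ltnS (leq_trans _ MN)// ltnW.
    by exists x => i; have := Hx (Ordinal (iN i)); rewrite /= ltn_ord.
  exists (maxn i (\max_t s t)) => N; rewrite geq_max => /andP[iN sN].
  apply: ((Ha N).2 (Ordinal (iN : i < N.+1))) => // t.
  by rewrite (leq_trans _ sN)// leq_bigmax.
apply: (ntp2_fin (k := k) (a := fun i j y => w (i, j, y)) ntp hP) => [eta|i s si].
  apply: jointly_sat_compact => // M; apply: (Hw (fun v _ =>
    jointly_sat P (fun (i : 'I_M) y => v (nat_of_ord i, eta i, y)))).
  by left; exists M, eta.
by apply: (Hw (fun v _ => ~ jointly_sat P (fun t y => v (i, s t, y)))); right; exists i, s.
Qed.

(** A choice of columns is coloured by the sets of rows along which it is consistent. On a subgrid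
    of constant colour, consistency along [N.+1] distinct rows for one choice gives it for all
    choices, which [ntp2_square] forbids. Hence [M] depends neither on [n] nor on the array. *)
Lemma inconsistent_path (X Y : finType) (P : (X -> C) -> (Y -> C) -> Prop) (k : nat) :
  dfn2 P -> exists M, forall n, exists B, forall a : 'I_n -> nat -> Y -> C,
    (forall i (s : 'I_k -> nat), injective s -> (forall t, s t < B) ->
       ~ jointly_sat P (fun t => a i (s t))) ->
    exists eta : 'I_n -> nat, (forall i, eta i < B) /\ kinconsistent P M (fun i => a i (eta i)).
Proof.
move=> hP; have [N HN] := ntp2_square k hP.
exists N.+1 => n.
pose ST : finType := {ffun 'I_N.+1 -> 'I_n}.
have [B HB] := grid_pigeonhole n N.+1 {ffun ST -> bool}.
exists B => a Ha.
have [F [Fi FB [t Ft]]] :=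
  HB (fun eta => [ffun s : ST => `[< jointly_sat P (fun u => a (s u) (eta (s u))) >]]).
exists (fun i => F i ord0); split=> // s si cs; apply: HN.
exists (fun u j => a (s u) (F (s u) j)); split=> [eta|i s' s'i]; last first.
  by apply: Ha => // u v /Fi /s'i.
(* The path [eta], given on the rows listed by [s], is extended by column 0 to a choice on all
   rows. *)
pose z (i : 'I_n) : 'I_N.+1 := oapp eta ord0 [pick u | s u == i].
have zs u : z (s u) = eta u.
  rewrite /z; case: pickP => [v /eqP/si -> //|/(_ u)]; by rewrite eqxx.
have Et : t (finfun s) = true.
  rewrite -(Ft (fun=> ord0)) ffunE; apply/asboolP.
  by case: cs => x Hx; exists x => u; rewrite ffunE.
move: Et; rewrite -(Ft z) ffunE => /asboolP[x Hx]; exists x => u.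
by have := Hx u; rewrite !ffunE zs.
Qed.

Section IndiscernibleLimit.
Context (X F : finType) (P : (X -> C) -> (F -> C) -> Prop) (hP : dfn2 P).
Context (al : nat -> F -> C) (M : nat).

Let V : countType := (bool * nat * F)%type.
Let va (v : V -> C) i x := v (true, i, x).
Let vb (v : V -> C) i x := v (false, i, x).

Let Sins : set ((V -> C) -> (void -> C) -> Prop) :=
  [set Q | exists k r (G : ('I_r -> F -> C) -> Prop) s, [/\ dfnS G, increasing s,
     forall s, increasing s -> G (fun i => al (s i)) &
     Q = fun v _ => G (fun i => insert_after (va v) (vb v) k (s i))]].

Let Sinc : set ((V -> C) -> (void -> C) -> Prop) :=
  [set Q | exists s : 'I_M -> nat, increasing s /\
     Q = fun v _ => ~ jointly_sat P (fun t => vb v (s t))].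

Let Sind : set ((V -> C) -> (void -> C) -> Prop) :=
  [set Q | exists r (G : ('I_r -> F -> C) -> Prop) s t, [/\ dfnS G, increasing s,
     increasing t & Q = fun v _ => G (fun i => vb v (s i)) -> G (fun i => vb v (t i))]].

Let dfn_Sins Q : Sins Q -> dfn2 Q.
Proof.
move=> [k [r [G [s [dG _ _ ->]]]]].
pose g (i : 'I_r) x : V + void :=
  inl (insert_after (fun j x => (true, j, x)) (fun j x => (false, j, x)) k (s i) x).
apply: dfn_ext (dfnS_ren g dG) => v.
suff -> : (fun i x => v (g i x)) = fun i => insert_after
   (va (fun x => v (inl x))) (vb (fun x => v (inl x))) k (s i) by [].
apply/funext => i; apply/funext => x.
by rewrite /g /insert_after; case: ifP => // _; case: ifP.
Qed.

Let dfn_Sinc Q : Sinc Q -> dfn2 Q.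
Proof.
move=> [s [_ ->]]; apply: dfn_not.
exact: (dfn_jointly_sat (fun t x => inl (false, s t, x)) hP).
Qed.

Let dfn_Sind Q : Sind Q -> dfn2 Q.
Proof.
move=> [r [G [s [t [dG _ _ ->]]]]]; apply: dfn_imp.
  exact: (dfnS_ren (fun i x => inl (false, s i, x)) dG).
exact: (dfnS_ren (fun i x => inl (false, t i, x)) dG).
Qed.

(** A first limit makes the inconsistent sequence infinite. Thinning both sequences simultaneously
    by Ramsey's theorem meets any finitely many indiscernibility conditions, and a second limit
    meets them all. *)
Lemma extract_indisc :
  (forall n, exists be : nat -> F -> C, (forall k, EMle al (insert_after al be k)) /\
     kinconsistent P M (fun i : 'I_n => be i)) ->
  exists al' be' : nat -> F -> C, [/\ forall k, EMle al (insert_after al' be' k),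
    indisc be' & ~ jointly_sat P be'].
Proof.
move=> /choice[be Hbe].
have [|Q|v Hv] := @realize_lim _ _ _ Kbig Csat V void (@of_void C)
    (fun n p => if p.1.1 then al p.1.2 p.2 else be n p.1.2 p.2) (Sins `|` Sinc).
- by move=> Q [/dfn_Sins|/dfn_Sinc].
- move=> [[k [r [G [s [dG hs Gal ->]]]]]|[s [hs ->]]].
    by exists 0 => n _; apply: ((Hbe n).1 k).
  exists (\max_t s t).+1 => n sn.
  have sb t : s t < n by rewrite (leq_trans _ sn)// ltnS leq_bigmax.
  apply: ((Hbe n).2 (fun t => Ordinal (sb t))) => t t' [].
  exact: (increasing_injective hs).
pose sub g (p : V) := v (p.1.1, g p.1.2, p.2).
(* Each condition can be achieved by a further thinning and then persists under all later ones, so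
   finitely many are met in succession. *)
have dense Q : (Sins `|` Sinc `|` Sind) Q -> forall g, smono g ->
    exists2 g', smono g' & forall g'', smono g'' -> Q (sub (g \o g' \o g'')) (@of_void C).
  move=> [[[k [r [G [s [dG hs Gal ->]]]]]|[s [hs ->]]]|
      [r [G [s [t [dG hs ht ->]]]]]] g hg.
  - exists id => // g'' hg''.
    have [h hh Hh] := insert_after_smono (va v) (vb v) k (smono_comp hg hg'').
    rewrite (_ : (fun i => _) = fun i => insert_after (va v) (vb v) (g (g'' k)) (h (s i))).
      apply: (Hv (fun v _ => G (fun i => insert_after (va v) (vb v) (g (g'' k)) (h (s i))))).
      by left; exists (g (g'' k)), r, G, (h \o s); split=> //; exact: smono_increasing.
    by apply/funext => i; exact: Hh.
  - exists id => // g'' hg''.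
    apply: (Hv (fun v _ => ~ jointly_sat P (fun t => vb v (g (g'' (s t)))))).
    right; exists (g \o g'' \o s); split=> //.
    by apply: smono_increasing => //; exact: smono_comp.
  - have [g' hg' Hg'] := ramsey (fun s : 'I_r -> nat => G (fun i => vb v (g (s i)))).
    by exists g' => // g'' hg''; apply: (Hg' (g'' \o s) (g'' \o t)); exact: smono_increasing.
have [|l lS|w Hw] := @realize _ _ _ Kbig Csat V void (@of_void C) (Sins `|` Sinc `|` Sind).
- by move=> Q [[/dfn_Sins|/dfn_Sinc]|/dfn_Sind].
- suff [g hg Hg] : exists2 g, smono g & forall g', smono g' ->
      forall Q, List.In Q l -> Q (sub (g \o g')) (@of_void C).
    by exists (sub (g \o id)) => Q; apply: Hg.
  elim: l lS => [|Q l IH] lS; first by exists id.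
  have [|g hg Hg] := IH; first by move=> R Rl; apply: lS; right.
  have [g' hg' Hg'] := dense Q (lS _ (or_introl erefl)) g hg.
  exists (g \o g') => [|g'' hg'' R [<-|Rl]]; [exact: smono_comp|exact: Hg'|].
  by apply: (Hg (g' \o g'')) => //; exact: smono_comp.
exists (va w), (vb w); split=> [k r G dG Gal s hs|r G s t dG hs ht|cs].
- apply: (Hw (fun v _ => G (fun i => insert_after (va v) (vb v) k (s i)))).
  by left; left; exists k, r, G, s.
- apply: (Hw (fun v _ => G (fun i => vb v (s i)) -> G (fun i => vb v (t i)))).
  by right; exists r, G, s, t.
- apply: (Hw (fun v _ => ~ jointly_sat P (fun t : 'I_M => vb v t))).
    by left; right; exists (@nat_of_ord M); split=> // i j.
  by case: cs => x Hx; exists x => t; exact: Hx.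
Qed.

End IndiscernibleLimit.

(** Were all rows [N]-inconsistent, [inconsistent_path] would choose columns forming
    [M]-inconsistent sequences of every length, and [extract_indisc] would turn these into a
    counterexample to resilience. *)
Lemma resilient_array (X F : finType) (P : (X -> C) -> (F -> C) -> Prop)
    (al : nat -> F -> C) (be : nat -> nat -> F -> C) : dfn2 P -> indisc al ->
  (forall eta k, EMle al (insert_after al (fun i => be i (eta i)) k)) ->
  jointly_sat P al ->
  forall N, exists i (s : 'I_N -> nat), injective s /\ jointly_sat P (fun t => be i (s t)).
Proof.
move=> hP ial ins cal N; apply: contrapT => /forallNP H.
have Hk i : kinconsistent P N (be i) by move=> s si cs; apply: (H i); exists s.
have [M HM] := inconsistent_path N hP.
have [n|al' [be' [ins' ibe' nc]]] := @extract_indisc X F P hP al M.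
  have [B /(_ (fun i => be i))[i s si _|eta [_ He]]] := HM n; first exact: Hk.
  exists (fun i => be i (oapp eta 0 (insub i))); split=> [k|].
    exact: (ins (fun i => oapp eta 0 (insub i))).
  rewrite (_ : (fun i : 'I_n => _) = fun i => be i (eta i))//.
  by apply/funext => i; rewrite valK.
apply: nc; apply: (resilient_fin (a := al') res hP) => //.
(* A finite tuple of [al'] lies before the insertion once this happens after its largest index. *)
- suff /EMle_indisc : EMle al al' by exact.
  move=> r G dG Gal s hs.
  have := ins' (\max_i s i) r G dG Gal s hs; congr G; apply/funext => i.
  by rewrite /insert_after leq_bigmax.
- by move=> k; exact: EMle_indisc (ins' k) ial.
- apply: jointly_sat_compact => // m.
  have := ins' m m (fun y => jointly_sat P y)
    (dfn_jointly_sat (fun i x => (i, x)) hP) _ (@nat_of_ord m).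
  have [x Hx] := cal; case=> [s _|//|y Hy]; first by exists x => i.
  exists y => i; have := Hy i; rewrite /insert_after ltnW//.
Qed.

End Sequences.

(** * Arrays over the given sequence *)

Section Blocks.

Lemma block_pos_subproof (M l : nat) (i : 'I_M) (t : 'I_l) : i * l + t < M * l.
Proof. by have := ltn_ord i; have := ltn_ord t; nia. Qed.

Definition block_pos (M l : nat) (i : 'I_M) (t : 'I_l) : 'I_(M * l) :=
  Ordinal (block_pos_subproof i t).

Lemma block_width_gt0 (M l : nat) (p : 'I_(M * l)) : 0 < l.
Proof. by case: l p => // -[p]; rewrite muln0. Qed.

Lemma block_quo_subproof (M l : nat) (p : 'I_(M * l)) : p %/ l < M.
Proof. by rewrite ltn_divLR ?(block_width_gt0 p). Qed.

Lemma block_rem_subproof (M l : nat) (p : 'I_(M * l)) : p %% l < l.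
Proof. by rewrite ltn_mod (block_width_gt0 p). Qed.

Definition block_quo (M l : nat) (p : 'I_(M * l)) : 'I_M := Ordinal (block_quo_subproof p).
Definition block_rem (M l : nat) (p : 'I_(M * l)) : 'I_l := Ordinal (block_rem_subproof p).

Lemma block_posK (M l : nat) (i : 'I_M) (t : 'I_l) :
  block_quo (block_pos i t) = i /\ block_rem (block_pos i t) = t.
Proof.
have l0 : 0 < l by apply: leq_ltn_trans (ltn_ord t).
split; apply/val_inj => /=; first by rewrite divnMDl// divn_small ?addn0.
by rewrite modnMDl modn_small.
Qed.

Definition blockinc (l : nat) (B : nat -> 'I_l -> nat) :=
  (forall i, increasing (B i)) /\ (forall i j t u, i < j -> B i t < B j u).

Lemma blockinc_increasing (M l : nat) (B : nat -> 'I_l -> nat) (s : 'I_M -> nat) :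
  blockinc B -> increasing s ->
  increasing (fun p : 'I_(M * l) => B (s (block_quo p)) (block_rem p)).
Proof.
move=> [B1 B2] hs p q pq.
have l0 := block_width_gt0 p.
have := divn_eq p l; have := divn_eq q l => Eq Ep.
case: (ltngtP (block_quo p) (block_quo q)) => /= H.
- by apply: B2; exact: hs.
- by have := ltn_mod q l; have := ltn_mod p l; nia.
- have -> : block_quo p = block_quo q by apply/val_inj.
  by apply: B1 => /=; move: H pq; nia.
Qed.

(** Flattening [r] blocks of length [l] into one increasing tuple of length [r * l] reduces the
    claim to [EMle_transfer]. *)
Lemma EM_blocks L (C : structure L) (F : Type) (l : nat) (a w w' : nat -> F -> C)
    (B B' : nat -> 'I_l -> nat) r (G : ('I_r -> 'I_l * F -> C) -> Prop) s s' :
  indisc a -> EMle a w -> EMle a w' -> blockinc B -> blockinc B' ->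
  dfnS G -> increasing s -> increasing s' ->
  G (fun i p => w (B (s i) p.1) p.2) -> G (fun i p => w' (B' (s' i) p.1) p.2).
Proof.
move=> ia aw aw' hB hB' dG hs hs' H.
pose G' (y : 'I_(r * l) -> F -> C) := G (fun i p => y (block_pos i p.1) p.2).
have dG' : dfnS G' by exact: (dfnS_ren (fun i p => (block_pos i p.1, p.2)) dG).
have E (v : nat -> F -> C) (D : nat -> 'I_l -> nat) (q : 'I_r -> nat) :
    (fun i (p : 'I_l * F) => v (D (q (block_quo (block_pos i p.1)))
       (block_rem (block_pos i p.1))) p.2) = fun i p => v (D (q i) p.1) p.2.
  by apply/funext => i; apply/funext => p; rewrite !(block_posK i p.1).1 (block_posK i p.1).2.
move: H; rewrite -(E w B s) -(E w' B' s') => H.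
exact: (EMle_transfer (G := G') ia aw aw' dG' (blockinc_increasing hB hs)
  (blockinc_increasing hB' hs') H).
Qed.

Lemma EMle_refl L (C : structure L) (F : Type) (a : nat -> F -> C) : EMle a a.
Proof. by move=> r G _. Qed.

End Blocks.

(** * Arrays and the contradiction with NTP2 *)

Section Pattern.
Context (L : language) (C : structure L) (K : Type).
Hypotheses (Kbig : card_lt K [set: formula L nat]) (Csat : saturated K C).
Hypotheses (ntp : NTP2 C) (res : omega_resilient C).
Context (n m : nat) (a : nat -> 'I_n -> C) (ia : indisc a).
Context (phi : ('I_n -> C) -> ('I_m -> C) -> Prop) (dphi : dfn2 phi).

(** The map [kap] prescribes the interleaving: [None] marks a given element of [y], [Some q] an
    inserted one satisfying [phi] with the chosen entry of row [q]. The property [th] is meant to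
    come from the Ehrenfeucht-Mostowski type of [a]. *)
Definition array_over (k r J l : nat) (kap : 'I_l -> option 'I_r)
    (th : ('I_l -> 'I_n -> C) -> Prop)
    (c : 'I_r * 'I_J.+1 * 'I_m -> C) (y : 'I_l * 'I_n -> C) : Prop :=
  (forall q, kinconsistent phi k (fun j x => c (q, j, x))) /\
  forall eta : {ffun 'I_r -> 'I_J.+1}, exists z : 'I_l * 'I_n -> C,
    th (fun t x => z (t, x)) /\
    forall t, match kap t with
      | None => forall x, z (t, x) = y (t, x)
      | Some q => phi (fun x => z (t, x)) (fun x => c (q, eta q, x))
      end.

Lemma dfn_array_over k r J l (kap : 'I_l -> option 'I_r) th : dfnS th ->
  dfn2 (@array_over k r J l kap th).
Proof.
move=> dth; apply: dfn_and.
  by apply: dfn_forall => q; exact: (dfn_kinconsistent k (fun j x => inl (q, j, x)) dphi).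
apply: dfn_forall => eta.
apply: (@dfn_ex _ _ _ _ (fun z (v : 'I_r * 'I_J.+1 * 'I_m + 'I_l * 'I_n -> C) =>
  th (fun t x => z (t, x)) /\
    forall t, match kap t with
      | None => forall x, z (t, x) = v (inr (t, x))
      | Some q => phi (fun x => z (t, x)) (fun x => v (inl (q, eta q, x)))
      end)).
apply: dfn_and; first exact: (dfnS_ren (fun t x => inl (t, x)) dth).
apply: dfn_forall => t; case: (kap t) => [q|].
  exact: (dfn2_ren (fun x => inl (t, x)) (fun x => inr (inl (q, eta q, x))) dphi).
by apply: dfn_forall => x; exact: dfn_eq.
Qed.

Definition arrays_exist k r := forall J l (kap : 'I_l -> option 'I_r) th, dfnS th ->
  (forall s, increasing s -> th (fun t => a (s t))) ->
  exists c, @array_over k r J l kap th c (fun p => a p.1 p.2).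

Lemma arrays_exist0 k : arrays_exist k 0.
Proof.
move=> J l kap th dth Hth; have [x0] := inhab C.
exists (fun=> x0); split=> [[]//|eta]; exists (fun p : 'I_l * 'I_n => a p.1 p.2); split.
  by apply: (Hth (@nat_of_ord l)) => i j.
by move=> t; case: (kap t) => // -[].
Qed.

Context (k : nat) (e : nat -> 'I_n -> C) (d : nat -> nat -> 'I_n -> C).
Context (c : nat -> 'I_m -> C).
Let u j i := if odd i then d j i./2 else e i./2.
Hypotheses (Hu : forall j, EMle a (u j)) (Hphi : forall j i, phi (d j i) (c j)).
Hypothesis (Hc : kinconsistent phi k c).

Let u_even j i : u j i.*2 = e i.
Proof. by rewrite /u odd_double doubleK. Qed.

Let u_odd j i : u j i.*2.+1 = d j i.
Proof. by rewrite /u /= odd_double /= uphalf_double. Qed.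

(** Elements of [d j] placed at the positions of the new row count as given elements for the old
    rows. Resilience finds one array of old rows that works for [J.+1] distinct values of [j]; the
    corresponding [c j] form the new row. *)
Lemma arrays_existS r : arrays_exist k r -> arrays_exist k r.+1.
Proof.
move=> IH J l kap th dth Hth.
pose kap' t := obind (unlift ord0) (kap t) : option 'I_r.
pose P : ('I_r * 'I_J.+1 * 'I_m -> C) -> ('I_l * 'I_n -> C) -> Prop := array_over k kap' th.
have dP : dfn2 P by exact: dfn_array_over.
(* Even positions of [u j] do not depend on [j]. *)
pose pa i (t : 'I_l) := (2 * l * i + t).*2.
(* Each block of [pa] is followed by a gap holding the [pb] block, which takes an odd position, an
   element of [d j], exactly where the new row is prescribed. *)
pose pb i (t : 'I_l) := (2 * l * i + l + t).*2 + (kap t == Some ord0).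
have hpa : blockinc pa.
  split=> [i t t' tt'|i j t t' ij]; rewrite /pa; first lia.
  by have := ltn_ord t; nia.
have hins b : blockinc (insert_after pa pb b).
  split=> [i t t' tt'|i j t t' ij]; rewrite /insert_after.
    by case: ifP => _; [|case: ifP => _]; rewrite /pa /pb; lia.
  have mono x y : x < y -> 2 * l * x + 2 * l <= 2 * l * y.
    by move=> xy; rewrite -mulnSr leq_mul2l xy orbT.
  have := ltn_ord t; have := ltn_ord t'; rewrite /pa /pb.
  case: (ltngtP i b.+1) => ib; case: (ltngtP j b.+1) => jb; rewrite ?ltnS; try lia.
  - by have := mono _ _ ij; move: ib jb; rewrite !ltnS => -> ->; lia.
  - have -> : (i <= b) by []. have -> : (j <= b) = false by lia.
    have := mono i j.-1; lia.
  - have -> : (i <= b) by []. rewrite jb ltnn.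
    case: (ltngtP i b) => ib'; [have := mono i b ib'; lia|lia|subst i; lia].
  - have -> : (i <= b) = false by lia. have -> : (j <= b) = false by lia.
    have := mono i.-1 j.-1; lia.
  - rewrite ib ltnn; have -> : (j <= b) = false by lia.
    have := mono b j.-1; lia.
pose al i (p : 'I_l * 'I_n) := u 0 (pa i p.1) p.2.
pose be i j (p : 'I_l * 'I_n) := u j (pb i p.1) p.2.
have ial : indisc al by move=> r' G s t dG hs ht; apply: (EM_blocks ia (Hu 0) (Hu 0)).
have ins eta b : EMle al (insert_after al (fun i => be i (eta i)) b).
  move=> r' G dG Gal s hs.
  (* After the insertion all blocks can be read inside the single sequence [u (eta b)]. *)
  have := EM_blocks ia (Hu 0) (Hu (eta b)) hpa (hins b) dG hs hs (Gal s hs).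
  congr G; apply/funext => i; apply/funext => p; rewrite /insert_after /al /be.
  case: ifP => _; last case: ifP => _ //; by rewrite /pa !u_even.
have cal : jointly_sat P al.
  apply: (jointly_sat_compact Kbig Csat) => // M.
  (* One array over the concatenation of [M] blocks, with [th] required in each block, serves all
     these blocks simultaneously. *)
  pose kM (p : 'I_(M * l)) := kap' (block_rem p).
  pose thM (z : 'I_(M * l) -> 'I_n -> C) := forall i : 'I_M, th (fun t => z (block_pos i t)).
  have dthM : dfnS thM.
    by apply: dfn_forall => i; exact: (dfnS_ren (fun t x => (block_pos i t, x)) dth).
  have [|c0 Hc0] := IH J (M * l) kM thM dthM.
    by move=> s hs i; apply: (Hth (fun t => s (block_pos i t))) => t t' tt'; apply: hs => /=; lia.
  pose G (y : 'I_(M * l) -> 'I_n -> C) := exists c0,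
    array_over (J := J) k kM thM c0 (fun p => y p.1 p.2).
  have dG : dfnS G.
    apply: (dfn_ex (P := fun c0 (v : 'I_(M * l) * 'I_n -> C) =>
      array_over k kM thM c0 (fun p => v (p.1, p.2)))).
    exact: (dfn2_ren inl (fun p => inr (p.1, p.2)) (dfn_array_over k J kM dthM)).
  have hM : increasing (@nat_of_ord M) by [].
  have hMl : increasing (@nat_of_ord (M * l)) by [].
  have [c1 [c1k Hc1]] : G (fun p => u 0 (pa (block_quo p) (block_rem p))).
    apply: (EMle_transfer (G := G) ia (@EMle_refl _ _ _ a) (Hu 0) dG hMl
      (blockinc_increasing hpa hM)).
    by exists c0.
  exists c1 => i; split=> // eta; have [z [thz Hz]] := Hc1 eta.
  exists (fun p => z (block_pos i p.1, p.2)); split; first exact: (thz i).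
  move=> t; have := Hz (block_pos i t); rewrite /kM (block_posK i t).2.
  case: (kap' t) => // H x; rewrite H.
  change (u 0 (pa (block_quo (block_pos i t)) t) x = al i (t, x)).
  by rewrite (block_posK i t).1.
have [i [s [si [c' Hc']]]] := resilient_array Kbig Csat ntp res dP ial ins cal J.+1.
pose c2 (p : 'I_r.+1 * 'I_J.+1 * 'I_m) :=
  oapp (fun q => c' (q, p.1.2, p.2)) (c (s p.1.2) p.2) (unlift ord0 p.1.1).
pose G (y : 'I_l -> 'I_n -> C) := exists c0,
  array_over (J := J) k kap th c0 (fun p => y p.1 p.2).
have dG : dfnS G.
  apply: (dfn_ex (P := fun c0 (v : 'I_l * 'I_n -> C) =>
    array_over k kap th c0 (fun p => v (p.1, p.2)))).
  exact: (dfn2_ren inl (fun p => inr (p.1, p.2)) (dfn_array_over k J kap dth)).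
(* At positions marked [None] the block [be i j] agrees with [u 0] at [pg], whatever [j] is, so [c2]
   is an array over this tuple. *)
pose pg (t : 'I_l) := (2 * l * i + l + t).*2.
have hpg : increasing pg by move=> t t' tt'; rewrite /pg; lia.
have hl : increasing (@nat_of_ord l) by [].
apply: (EMle_transfer (G := G) ia (Hu 0) (@EMle_refl _ _ _ a) dG hpg hl).
exists c2; split=> [q|eta].
  rewrite /c2 /=; case: (unliftP ord0 q) => [q' _|_] /=; first exact: ((Hc' ord0).1 q').
  by move=> s' s'i; apply: (Hc (s := s \o s')) => t t' /si /s'i.
have [z [thz Hz]] := (Hc' (eta ord0)).2 [ffun q => eta (lift ord0 q)].
exists z; split=> // t; have := Hz t; rewrite /kap' /be /pb.
case: (kap t) => [q|] /=; last first.
  by move=> H x; rewrite H addn0 !u_even.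
rewrite /c2 /=; case: (unliftP ord0 q) => [q' ->|->] /=; first by rewrite ffunE.
rewrite addn1 u_odd => H.
by have -> : (fun x => z (t, x)) = d (s (eta ord0)) (2 * l * i + l + t); first exact/funext.
Qed.

(** The element with index [t] codes the function [zt t], and [Th r] says that the colouring by
    evaluation at [r] is induced by an [M]-inconsistent sequence. If [a] satisfied every [Th r],
    these sequences would form the square excluded by the choice of [N]. *)
Lemma no_dividing_pattern : False.
Proof.
have cl r : arrays_exist k r by elim: r => [|r]; [exact: arrays_exist0|exact: arrays_existS].
have [M HM] := inconsistent_path Kbig Csat ntp k dphi.
have [N HN] := ntp2_square Kbig Csat ntp M dphi.
pose ZT : finType := {ffun 'I_N.+1 -> 'I_N.+1}.
pose zt (t : 'I_#|ZT|) : ZT := enum_val t.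
pose Th (r : 'I_N.+1) (z : 'I_#|ZT| -> 'I_n -> C) := exists y : 'I_N.+1 * 'I_m -> C,
  kinconsistent phi M (fun q x => y (q, x)) /\ forall t, phi (z t) (fun x => y (zt t r, x)).
have dTh r : dfnS (Th r).
  apply: (dfn_ex (P := fun y (v : 'I_#|ZT| * 'I_n -> C) =>
     kinconsistent phi M (fun q x => y (q, x)) /\
     forall t, phi (fun x => v (t, x)) (fun x => y (zt t r, x)))).
  apply: dfn_and; first exact: (dfn_kinconsistent M (fun q x => inl (q, x)) dphi).
  apply: dfn_forall => t.
  exact: (dfn2_ren (fun x => inr (t, x)) (fun x => inl (zt t r, x)) dphi).
have [r Hr] : exists r, ~ Th r (fun t : 'I_#|ZT| => a t).
  apply: contrapT => /forallNP H; apply: HN.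
  have /choice[y Hy] : forall r : 'I_N.+1, exists y : 'I_N.+1 * 'I_m -> C,
      kinconsistent phi M (fun q x => y (q, x)) /\
      forall t : 'I_#|ZT|, phi (a t) (fun x => y (zt t r, x)).
    by move=> r; apply: contrapT; exact: H.
  exists (fun r q x => y r (q, x)); split=> [eta|r]; last exact: (Hy r).1.
  exists (a (enum_rank (finfun eta : ZT))) => r.
  by have := (Hy r).2 (enum_rank (finfun eta : ZT)); rewrite /zt enum_rankK ffunE.
have [B HB] := HM N.+1.
(* An array is taken whose interleavings all refute [Th r]; an [M]-inconsistent choice of its
   columns then establishes [Th r]. *)
have [s hs|c' [c'k Hc']] := cl _ B _ (fun t => Some (zt t r))
    (fun z => ~ Th r z) (dfn_not (dTh r)).
  by move=> /(ia (s := s) (t := @nat_of_ord _) (dTh r) hs) H; apply: Hr; apply: H.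
have [q s si sB|eta [eB He]] := HB (fun q j x => c' (q, inord j, x)).
  apply: (c'k q (fun t => inord (s t))) => t t' /(congr1 val) /=.
  by rewrite !inordK ?(leq_trans (sB _))// => /si.
have [z [nTh Hz]] := Hc' [ffun q => inord (eta q)].
apply: nTh; exists (fun p => c' (p.1, inord (eta p.1), p.2)); split=> // t.
by have := Hz t; rewrite ffunE.
Qed.

End Pattern.

(** * From dividing over the even part to the forbidden pattern *)

Theorem theorem4p4 (L : language) (T : set (sentence L)) (C : structure L)
    (hT : complete_theory T) (hC : monster_model T C)
    (hres : omega_resilient C) (hNTP2 : NTP2 C)
    (n m : nat) (a : nat -> 'I_n -> C) (ha : indiscernible a)
    (phi : formula L ('I_n + 'I_m)) (b : 'I_m -> C)
    (hdiv : divides_over (even_part a) phi b) :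
  finite_set [set i : nat | ~ sat (vcat (a i) b) (f_not phi)].
Proof.
have [_ [K [Kbig Csat _]]] := hC.
have [c [ic c0 nc]] := hdiv.
pose P (x : 'I_n -> C) (y : 'I_m -> C) := sat (vcat x y) phi.
have dP : dfn2 P by exact: dfn2_sat.
have ia := indiscernible_over_indisc ha.
have ic' := indiscernible_over_indisc ic.
pose par (h : nat -> nat) j (q : nat * 'I_n + 'I_m) :=
  match q with inl p => a (2 * h p.1) p.2 | inr y => c j y end.
(* All [c j] have the same type over the even part, since [c] is indiscernible over it. *)
have same h j (Q : (nat * 'I_n + 'I_m -> C) -> Prop) : dfn Q -> Q (par h 0) -> Q (par h j).
  move=> [f Hf] /Hf H; apply/Hf.
  pose el (p : nat * 'I_n) : even_part a :=
    SigSub (mem_set (ex_intro _ (h p.1) (ex_intro _ p.2 erefl)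
      : even_part a (a (2 * h p.1) p.2))).
  pose g (q : nat * 'I_n + 'I_m) : 'I_1 * 'I_m + even_part a :=
    match q with inl p => inr (el p) | inr y => inl (ord0, y) end.
  have E i : par h i = fun q => vcat (fun p : 'I_1 * 'I_m => c i p.2) val (g q).
    by apply/funext => -[].
  have inc1 i : increasing (fun _ : 'I_1 => i) by move=> x y; rewrite !ord1.
  have := ic 1 (fren g f) _ _ (inc1 0) (inc1 j).
  by rewrite !sat_fren (E j) => -[H' _]; apply: H'; rewrite -(E 0).
have neven i : ~ P (a (2 * i)) (c 0).
  move=> H; apply: nc; exists (a (2 * i)) => j.
  apply: (@same id j (fun v => P (fun x => v (inl (i, x))) (fun y => v (inr y)))) => //.
  exact: (dfn2_ren (fun x => inl (i, x)) inr dP).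
(* Compactness gives an inconsistent initial segment of [c], and indiscernibility spreads this to
   all tuples of that length, after sorting. *)
have [k Hk] : exists k, kinconsistent P k c.
  have [M HM] : exists M, ~ jointly_sat P (fun i : 'I_M => c i).
    apply: contrapT => /forallNP H; apply: nc.
    apply: (jointly_sat_compact Kbig Csat dP) => M.
    by apply: contrapT; exact: H.
  exists M => s si [x Hx]; apply: HM.
  have [t ht ts] := sort_injective si.
  apply: (ic' _ (fun y => jointly_sat P y) t (@nat_of_ord M)) => //.
    exact: (dfn_jointly_sat (fun i x => (i, x)) dP).
  by exists x => i; have [j ->] := ts i.
apply: contrapT => inf.
have /unbounded_smono[f hf Sf] : forall i, exists2 j, i < j & P (a j) (c 0).
  move=> i; apply: contrapT => H; apply: inf.
  apply: (@sub_finite_set _ _ `I_i.+1); last exact: finite_II.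
  move=> j /= Hj; rewrite ltnS leqNgt; apply/negP => ij; apply: H; exists j => //.
  by rewrite c0; apply: contrapT.
have fodd i : odd (f i).
  apply/negPn/negP => fe; apply: (neven (f i)./2).
  by rewrite mul2n even_halfK.
(* Since [f] has odd values, [g] is even at even arguments and equals [f] at odd ones; it is
   increasing because successive values of [f] differ by at least two. *)
pose g i := f i + ~~ odd i.
have hg : smono g.
  apply: smonoS => i; have := hf _ _ (ltnSn i); have := fodd i; have := fodd i.+1.
  by rewrite /g /=; case: (odd i); lia.
pose h i := (f i.*2).+1./2.
have gh i : g i.*2 = 2 * h i.
  by rewrite /g /h odd_double mul2n even_halfK ?addn1//= fodd.
pose w (v : nat * 'I_n -> C) (y : nat * 'I_n + 'I_m -> C) i x :=
  if odd i then v (i./2, x) else y (inl (i./2, x)).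
pose S1 : set ((nat * 'I_n -> C) -> (nat * 'I_n + 'I_m -> C) -> Prop) :=
  [set Q | exists r (G : ('I_r -> 'I_n -> C) -> Prop) s, [/\ dfnS G, increasing s,
    forall s, increasing s -> G (fun i => a (s i)) &
    Q = fun v y => G (fun i => w v y (s i))]].
pose S2 : set ((nat * 'I_n -> C) -> (nat * 'I_n + 'I_m -> C) -> Prop) :=
  range (fun i v y => P (fun x => v (i, x)) (fun x => y (inr x))).
(* For [c 0] the odd-indexed terms of [a \o g] solve the conditions; [transfer] carries a solution
   to each [c j] over the same even terms. *)
have /choice[v Hv] : forall j, exists v, forall Q, (S1 `|` S2) Q -> Q v (par h j).
  move=> j; apply: (transfer Kbig Csat (u := par h 0)).
  - move=> _ [[r [G [s [dG _ _ ->]]]]|[i _ <-]]; last first.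
      exact: (dfn2_ren (fun x => inl (i, x)) (fun x => inr (inr x)) dP).
    pose g' (i : 'I_r) x : nat * 'I_n + (nat * 'I_n + 'I_m) :=
      if odd (s i) then inl ((s i)./2, x) else inr (inl ((s i)./2, x)).
    apply: dfn_ext (dfnS_ren g' dG) => z.
    suff -> : (fun i x => z (g' i x)) = fun i =>
      w (fun x => z (inl x)) (fun y => z (inr y)) (s i) by [].
    by apply/funext => i; apply/funext => x; rewrite /g' /w; case: ifP.
  - by move=> Q; exact: same.
  - exists (fun p => a (g p.1.*2.+1) p.2) => _ [[r [G [s [dG hs Ga ->]]]]|[i _ <-]].
      have := Ga _ (smono_increasing hg hs); congr G.
      apply/funext => i; apply/funext => x; rewrite /w /=.
      by rewrite -gh -{1}(odd_double_half (s i)); case: (odd (s i)).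
    by rewrite /g /= odd_double addn0; exact: Sf.
apply: (@no_dividing_pattern _ _ _ Kbig Csat hNTP2 hres n m a ia P dP k
  (fun i x => a (2 * h i) x) (fun j i x => v j (i, x)) c) => //.
  move=> j r G dG Ga s hs.
  have : G (fun i => w (v j) (par h j) (s i)).
    by apply: (Hv j (fun v y => G (fun i => w v y (s i)))); left; exists r, G, s.
  by congr G; apply/funext => i; rewrite /w /=; case: odd.
move=> j i; apply: (Hv j (fun v y => P (fun x => v (i, x)) (fun x => y (inr x)))).
by right; exists i.
Qed.
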